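(* Let $\mathcal{W}$ be a simple random walk on $\mathbb{Z}^2$, viewed as an infinite word whose letters are chosen independently and uniformly at random from $\{\mathbf{x},-\mathbf{x},\mathbf{y},-\mathbf{y}\}$, where $\mathbf{x}=(1,0)$ and $\mathbf{y}=(0,1)$. Then, almost surely, there exists a (random, i.e. depending on $\mathcal{W}$) spanning subgraph $H\subset\mathbb{Z}^2$ for which the induced walk $\mathcal{W}_H$ (1) visits each site reachable from the origin in $H$ only finitely many times, and (2) fails to visit infinitely many sites reachable from the origin in $H$ (that is, the set of sites reachable from the origin in $H$ that are never visited by $\mathcal{W}_H$ is infinite).
   Context: $\mathbb{Z}^2$ denotes the square lattice, regarded as a graph with vertex set $\mathbb{Z}^2$ and edges between points at Euclidean distance $1$. A spanning subgraph $G\subset\mathbb{Z}^2$ has vertex set all of $\mathbb{Z}^2$ and an arbitrary subset of the edges of the lattice. Induced walk: given an infinite word $\mathcal{W}=w_1w_2w_3\cdots$ on the alphabet $\{\mathbf{x},-\mathbf{x},\mathbf{y},-\mathbf{y}\}$ and a spanning subgraph $G\subset\mathbb{Z}^2$, the induced walk $\mathcal{W}_G$ on $G$ starts at the origin, and reads the letters of $\mathcal{W}$ one at a time: if the walk is at $v$ and the next letter is $w$, then it moves to $v+w$ if the edge $\{v,v+w\}$ is present in $G$, and stands still at $v$ otherwise. A site is reachable from the origin in $G$ if it lies in the connected component of the origin in $G$. *)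

(* Defs.v *)
From HB Require Import structures.
From mathcomp Require Import all_boot all_order all_algebra finmap.
From mathcomp Require Import all_classical all_reals all_analysis.

Set Implicit Arguments.
Unset Strict Implicit.
Unset Printing Implicit Defensive.

Import Order.TTheory GRing.Theory Num.Theory.

Local Open Scope classical_set_scope.
Local Open Scope ring_scope.

Notation site := (int * int)%type.

Variant letter := Xpos | Xneg | Ypos | Yneg.

Definition step (a : letter) : site :=
  match a with
  | Xpos => (1, 0)
  | Xneg => (-1, 0)
  | Ypos => (0, 1)
  | Yneg => (0, -1)
  end.

Definition letter_to_bools (a : letter) : bool * bool :=
  match a with
  | Xpos => (false, false)
  | Xneg => (false, true)
  | Ypos => (true, false)
  | Yneg => (true, true)
  end.

Definition letter_of_bools (b : bool * bool) : letter :=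
  match b with
  | (false, false) => Xpos
  | (false, true) => Xneg
  | (true, false) => Ypos
  | (true, true) => Yneg
  end.

Lemma letter_to_boolsK : cancel letter_to_bools letter_of_bools.
Proof. by case. Qed.

HB.instance Definition _ := Finite.copy letter (can_type letter_to_boolsK).
HB.instance Definition _ := isPointed.Build letter Xpos.
HB.instance Definition _ := @isMeasurable.Build default_measure_display
  letter discrete_measurable discrete_measurable0
  discrete_measurableC discrete_measurableU.

(* Euclidean distance 1, written with squared distances to stay in int. *)
Definition lattice_adj : rel site :=
  fun u v => (u.1 - v.1) ^+ 2 + (u.2 - v.2) ^+ 2 == 1.

Record spanning_subgraph := SpanningSubgraph {
  edge :> rel site;
  edge_sym : symmetric edge;
  edge_lattice : subrel edge lattice_adj
}.

Definition reachable (H : spanning_subgraph) (v : site) : Prop :=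
  exists p : seq site, path H 0 p /\ last 0 p = v.

(* [w n] is the (n+1)-st letter of the word: it is read at the step from
   time n to time n+1. *)
Fixpoint induced_walk (w : nat -> letter) (H : spanning_subgraph) (n : nat) :
    site :=
  match n with
  | 0 => 0
  | m.+1 =>
      let v := induced_walk w H m in
      if H v (v + step (w m)) then v + step (w m) else v
  end.

Section independence.
Context d (T : measurableType d) (R : realType) (P : probability T R).
Context d' (S : measurableType d').

(* The product rule over every finite subfamily. *)
Definition mutually_independent (X : nat -> {RV P >-> S}) : Prop :=
  forall (J : {fset nat}) (A : nat -> set S),
    (forall n, measurable (A n)) ->
    P (\bigcap_(n in [set` J]) (X n @^-1` A n)) =
    (\prod_(n <- J) P (X n @^-1` A n))%E.

End independence.

Definition uniform_letter d (T : measurableType d) (R : realType)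
    (P : probability T R) (X : {RV P >-> letter}) : Prop :=
  forall a : letter, distribution P X [set a] = (4^-1)%:E.

(* Main.v *)
Require Import Defs.
From mathcomp Require Import all_boot all_order all_algebra finmap.
From mathcomp Require Import all_classical all_reals all_analysis.
From mathcomp Require Import zify ring lra.

(** The maze is a sequence of arenas (slabs of consecutive columns with all
    lattice edges) joined by horizontal corridors, and it is built with knowledge
    of the future of the word.  In an arena, each time the walk first reaches one
    of the prescribed columns a trial starts; the trial succeeds when the walk
    climbs to the end of a block of [m] columns before stepping back out of it.
    The letters of a successful trial would equally carry the walk through a
    corridor of length [m] on the row where the trial began, so one declares the
    block to be that corridor, and the walk enters a fresh arena behind it.  A
    trial succeeds with probability [1/(m+1)], and successive trials are
    independent.  The planarity of the arena makes the chance of going back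
    through a corridor of length [m] before reaching column [a] of order
    [log a / m].  With [m = 4^k] at stage [k] the failure probabilities are
    summable; starting the construction at stage [k] and letting [k] tend to
    infinity, almost surely some start never fails.  The walk then never returns
    through a corridor, hence visits each column during a bounded time, while
    every column of an arena is connected and infinite. *)

Set Implicit Arguments.
Unset Strict Implicit.
Unset Printing Implicit Defensive.

Import Order.TTheory GRing.Theory Num.Theory.

Local Open Scope classical_set_scope.
Local Open Scope ring_scope.

(** * The exploration process *)

(* Length of the corridor leading into the arena of stage [k]. *)
Definition corridor (k : nat) : nat := 4 ^ k.

(** The factor [2 ^ k] brings the probability that all trials of a stage fail down to at most
    [2 ^ -k]. *)
Definition trials (k : nat) : nat := 2 ^ k * corridor k.+1.

(* [base] is the left wall of the current arena, [row] the row of the corridor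
   that ends there, and [trow] the row on which the current trial started.  The
   position ([posx], [posy]) is the one obtained if the current trial fails. *)
Record state := State {
  stage : nat; base : int; row : int;
  trial : nat; posx : int; posy : int; trow : int }.

(* [gate] is the column where the current (or next) trial starts, [goal] the one
   where it succeeds. *)
Definition gate (s : state) : int :=
  base s + 1 + (trial s * corridor (stage s).+1)%:Z.

Definition goal (s : state) : int := gate s + (corridor (stage s).+1)%:Z.

(** Nothing bounds the arena to the east, since its end is fixed only in hindsight. The wall at
    column [base s] is open on row [row s] only. *)
Definition arena_move (s : state) (a : letter) : site :=
  match a with
  | Xpos => (posx s + 1, posy s)
  | Xneg => if (base s < posx s) || (posy s == row s)
            then (posx s - 1, posy s) else (posx s, posy s)
  | Ypos => (posx s, if base s <= posx s then posy s + 1 else posy s)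
  | Yneg => (posx s, if base s <= posx s then posy s - 1 else posy s)
  end.

Definition start (k : nat) (b r : int) : state := State k b r 0 b r r.

(** [None] means failure: the walk has left the corridor at its western end or has lost its last
    trial. A lost trial moves the gate to the former goal. West of the gate [trow] follows the walk,
    so it holds the row where the gate is reached and stays frozen during the trial. *)
Definition advance (s : state) (a : letter) : option state :=
  let p := arena_move s a in
  if p.1 < base s - (corridor (stage s))%:Z then None
  else if goal s <= p.1 then Some (start (stage s).+1 (goal s) (trow s))
  else if (gate s <= posx s) && (p.1 < gate s) then
    if ((trial s).+1 < trials (stage s))%N then
      Some (State (stage s) (base s) (row s) (trial s).+1 p.1 p.2 (trow s))
    else None
  else Some (State (stage s) (base s) (row s) (trial s) p.1 p.2
               (if gate s <= posx s then trow s else p.2)).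

Record valid (s : state) : Prop := Valid {
  valid_left : base s - (corridor (stage s))%:Z <= posx s;
  valid_right : posx s < goal s;
  valid_corridor : posx s < base s -> posy s = row s;
  valid_trial : (trial s < trials (stage s))%N }.

Lemma corridor_gt0 k : (0 < corridor k)%N.
Proof. by rewrite expn_gt0. Qed.

Lemma trials_gt0 k : (0 < trials k)%N.
Proof. by rewrite muln_gt0 expn_gt0 corridor_gt0. Qed.

Lemma valid_start k b r : valid (start k b r).
Proof.
have := corridor_gt0 k; have := corridor_gt0 k.+1.
by split=> //=; rewrite ?trials_gt0 /goal /gate //=; lia.
Qed.

Lemma arena_move_x s a : `|(arena_move s a).1 - posx s| <= 1.
Proof. by case: a => /=; try case: ifP => _ /=; lia. Qed.

Lemma valid_advance s a s' : valid s -> advance s a = Some s' -> valid s'.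
Proof.
move=> [h1 h2 h3 h4]; rewrite /advance.
have mx := arena_move_x s a.
have my : (arena_move s a).1 < base s -> (arena_move s a).2 = row s.
  move: h1 h3; case: a mx => /= _ h1 h3.
  - by move=> ?; apply: h3; lia.
  - case: ifP => /= [/orP[?|/eqP ->//]|/negbT]; first by lia.
    by rewrite negb_or => /andP[? /eqP h] /h3.
  - by case: ifP => //; lia.
  - by case: ifP => //; lia.
case: ifPn => // c1; case: ifPn => [c2 [<-]|c2]; first exact: valid_start.
case: ifPn => [/andP[c3 c4]|c3].
  case: ifPn => // c5 [<-]; split=> //=; first by lia.
  by move: h1 h2 c1 c2 c3 c4; rewrite /goal /gate /= mulSn; lia.
by move=> [<-]; split=> //=; rewrite /goal /gate /=; move: c1 c2; rewrite /goal /gate; lia.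
Qed.

(** * A supermartingale bounding the failure probability *)

Section potential.
Context (R : realType).
Implicit Types (k : nat) (x y : R).

(* This is [(x + 1/2)^2 + y^2 + 3/4]: centred at [-1/2], so that a westward step
   refused by the wall at [x = 0] is a reflection, and the constant makes the
   logarithm subharmonic for the discrete Laplacian. *)
Definition quad x y : R := x ^+ 2 + x + 1 + y ^+ 2.

Lemma quad_gt0 x y : 0 < quad x y.
Proof. by rewrite /quad; nra. Qed.

(** After exponentiation this compares the product of the four neighbouring values with a fourth
    power, and the difference is an explicit positive polynomial. *)
Lemma ln_quad_subharmonic x y :
  4 * ln (quad x y) <= ln (quad (x + 1) y) + ln (quad (x - 1) y)
                       + ln (quad x (y + 1)) + ln (quad x (y - 1)).
Proof.
have p x' y' : quad x' y' \is Num.pos by rewrite posrE quad_gt0.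
have -> : 4 * ln (quad x y) = ln (quad x y * quad x y * quad x y * quad x y).
  by rewrite !lnM ?rpredM //; ring.
rewrite -!lnM ?rpredM //; rewrite ler_ln ?rpredM //.
rewrite -subr_ge0.
have -> : quad (x + 1) y * quad (x - 1) y * quad x (y + 1) * quad x (y - 1) -
  quad x y * quad x y * quad x y * quad x y =
  quad x y ^+ 2 + 6 * quad x y + 4 + (4 * (x + 2^-1) * y) ^+ 2.
  by rewrite /quad; field.
have := quad_gt0 x y; have := sqr_ge0 (4 * (x + 2^-1) * y); nra.
Qed.

(** Stage [k] extends at most [1 + 2^(5k+4)] columns east of its wall; [box k] is 16 times the
    square of [2^(5k+4)], which dominates [x^2 + x + 1] there. *)
Definition box k : R := 2 ^+ (10 * k + 12).

(* The discrete harmonic term [y^2 - x^2 - x] compensates the logarithm for large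
   [y], so that the sum is nonnegative on the whole strip. *)
Definition green k x y : R :=
  (10 * k + 12)%:R - ln (quad x y) + (y ^+ 2 - x ^+ 2 - x + box k) / box k.

Lemma box_gt0 k : 0 < box k.
Proof. by rewrite exprn_gt0. Qed.

Lemma green_superharmonic k x y :
  green k (x + 1) y + green k (x - 1) y + green k x (y + 1) + green k x (y - 1)
  <= 4 * green k x y.
Proof.
have := ln_quad_subharmonic x y; rewrite /green.
set a := ln _; set b := ln _; set c := ln _; set d := ln _; set e := ln _ => H.
have b0 := box_gt0 k.
have -> : ((x + 1) ^+ 2) = x ^+ 2 + 2 * x + 1 by ring.
have := divff (lt0r_neq0 b0); set i := (box k)^-1 => ii.
nra.
Qed.

Lemma green_reflect k y : green k (0 - 1) y = green k 0 y.
Proof. by rewrite /green /quad; congr (_ - ln _ + _ / _); ring. Qed.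

Lemma ln2_ge_half : 2^-1 <= ln (2 : R).
Proof.
have h : ln (2^-1 : R) <= - 2^-1.
  have -> : ln (2^-1 : R) = ln (1 + - 2^-1) by congr ln; field.
  by apply: le_ln1Dx; lra.
have : ln (2 * 2^-1 : R) = 0 by rewrite divff ?ln1.
rewrite lnM ?posrE; lra.
Qed.

Lemma ln2_le1 : ln (2 : R) <= 1.
Proof. by apply: (@le_ln1Dx R 1); lra. Qed.

Lemma green_origin k : green k 0 0 = (10 * k + 13)%:R.
Proof.
rewrite /green; have -> : quad 0 0 = 1 by rewrite /quad; ring.
have -> : 0 ^+ 2 - 0 ^+ 2 - 0 + box k = box k by ring.
by rewrite ln1 subr0 divff ?lt0r_neq0 ?box_gt0 // natr1 -addnS.
Qed.

(** Superharmonicity at the opening of the wall, whose western neighbour lies in the corridor and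
    carries the linear value [green k 0 0 + 1]. The quadratic terms cancel and the logarithms lose
    at least [3 * ln 2 >= 3/2]. *)
Lemma green_entrance k :
  green k (0 + 1) 0 + green k 0 (0 + 1) + green k 0 (0 - 1) + 1
  <= 3 * green k 0 0.
Proof.
rewrite /green.
have -> : quad 0 0 = 1 by rewrite /quad; ring.
have -> : quad (0 + 1) 0 = 3 by rewrite /quad; ring.
have -> : quad 0 (0 + 1) = 2 by rewrite /quad; ring.
have -> : quad 0 (0 - 1) = 2 by rewrite /quad; ring.
rewrite ln1; have l2 := ln2_ge_half.
have l3 : ln (2 : R) <= ln 3 by rewrite ler_ln ?posrE //; lra.
have b0 := box_gt0 k.
have := divff (lt0r_neq0 b0); set i := (box k)^-1 => ii.
nra.
Qed.

(** The quadratic term absorbs the logarithm, as [quad x y <= box k * (1 + u)] with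
    [u = y^2 / box k], and [ln (1 + u) <= u]. *)
Lemma green_ge0 k x y : 0 <= x -> x ^+ 2 + x + 1 <= box k -> 0 <= green k x y.
Proof.
move=> x0 xb; have b0 := box_gt0 k.
have h : ln (quad x y) <= (10 * k + 12)%:R + y ^+ 2 / box k.
  have u0 : 0 <= y ^+ 2 / box k by rewrite divr_ge0 ?sqr_ge0 // ltW.
  have q : quad x y <= box k * (1 + y ^+ 2 / box k).
    rewrite mulrDr mulr1 mulrC divfK ?lt0r_neq0 //.
    by rewrite /quad lerD2r.
  apply: (@le_trans _ _ (ln (box k * (1 + y ^+ 2 / box k)))).
    rewrite ler_ln ?posrE ?quad_gt0 // mulr_gt0 //; lra.
  rewrite lnM ?posrE //; last by lra.
  apply: lerD; last by apply: le_ln1Dx; lra.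
  (* The constant of [green] bounds [ln (box k)] because [ln 2 <= 1]. *)
  rewrite /box; elim: (10 * k + 12)%N => [|n IH]; first by rewrite expr0 ln1.
  rewrite exprS lnM ?posrE ?exprn_gt0 // -natr1.
  by have := ln2_le1; lra.
have : (y ^+ 2 - x ^+ 2 - x + box k) / box k
   = y ^+ 2 / box k + (box k - x ^+ 2 - x) / box k by rewrite -mulrDl; congr (_ / _); ring.
have : 0 <= (box k - x ^+ 2 - x) / box k by apply: divr_ge0; lra.
rewrite /green; lra.
Qed.

(* At [x = - corridor k - 1] this is at least [1]; it bounds the probability of
   going back through the corridor. *)
Definition return_risk k (x y : int) : R :=
  (if x < 0 then (10 * k + 13)%:R - x%:~R else green k x%:~R y%:~R)
  / (corridor k).+1%:R.

(** Gambler's ruin: the probability of stepping back from the gate before climbing [corridor k.+1]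
    columns. *)
Definition trial_ratio k : R := (corridor k.+1)%:R / (corridor k.+1).+1%:R.

(* The probability that all remaining trials fail, when the walk is at column
   [x] after a step from [s]. *)
Definition trial_risk (s : state) (x : int) : R :=
  if gate s <= posx s then
    trial_ratio (stage s) ^+ (trials (stage s) - (trial s).+1)
    * (goal s - x)%:~R / (corridor (stage s).+1).+1%:R
  else trial_ratio (stage s) ^+ (trials (stage s) - trial s).

(** In units of [1 / 2 ^ k]: 13 for a return, 1 for the trials, and 14, half of 28, for the later
    stages. *)
Definition future_risk k : R := 28%:R / 2 ^+ k.

(** A union bound over the ways to fail: return, loss of all trials, failure at a later stage. *)
Definition risk (o : option state) : R :=
  if o is Some s then
    return_risk (stage s) (posx s - base s) (posy s - row s)
    + trial_risk s (posx s) + future_risk (stage s).+1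
  else 1.

Lemma return_risk_move s : valid s ->
  let h a := return_risk (stage s) ((arena_move s a).1 - base s)
                                   ((arena_move s a).2 - row s) in
  h Xpos + h Xneg + h Ypos + h Yneg
  <= 4 * return_risk (stage s) (posx s - base s) (posy s - row s).
Proof.
move=> [_ _ hc _] /=; rewrite /return_risk -!mulrDl mulrA.
apply: ler_wpM2r; first by rewrite invr_ge0 ler0n.
have [lt_b|le_b] := ltP (posx s) (base s).
  have e : posy s - row s = 0 by rewrite hc // subrr.
  rewrite hc // eqxx orbT /= !subrr.
  have -> : (posx s - base s < 0) by lia.
  have -> : (posx s - 1 - base s < 0) by lia.
  (* At the mouth of the corridor the linear formula and [green] agree. *)
  have -> : (if posx s + 1 - base s < 0
      then (10 * stage s + 13)%:R - (posx s + 1 - base s)%:~R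
      else green (stage s) (posx s + 1 - base s)%:~R 0%:~R)
      = (10 * stage s + 13)%:R - (posx s + 1 - base s)%:~R :> R.
    case: ifPn => // ge0.
    have -> : posx s + 1 - base s = 0 by lia.
    by rewrite green_origin subr0.
  by rewrite !(intrD, intrB, rmorphN) /=; lra.
have -> : (posx s - base s < 0) = false by lia.
have -> : (posx s + 1 - base s < 0) = false by lia.
have -> : posx s + 1 - base s = (posx s - base s) + 1 by ring.
have -> : posy s + 1 - row s = (posy s - row s) + 1 by ring.
have -> : posy s - 1 - row s = (posy s - row s) - 1 by ring.
have [lt_b|] /= := ltP (base s) (posx s).
  have -> : (posx s - 1 - base s < 0) = false by lia.
  have -> : posx s - 1 - base s = (posx s - base s) - 1 by ring.
  by rewrite !(intrD _ _ 1) !(intrD _ _ (-1)); exact: green_superharmonic.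
move=> ge_b; rewrite !(intrD _ _ 1) !(intrD _ _ (-1)).
have -> : posx s - base s = 0 by lia.
case: (posy s =P row s) => [-> | _] /=.
  have -> : posx s - 1 - base s = - 1 by lia.
  have := green_entrance (stage s); rewrite !subrr green_origin.
  have -> : (- (1) < 0 :> int) by [].
  rewrite [(- (1))%:~R]rmorphN /=; lra.
have -> : (posx s - base s < 0) = false by lia.
have -> : posx s - base s = 0 by lia.
by rewrite -[X in _ + X + _ + _ <= _]green_reflect; exact: green_superharmonic.
Qed.

Lemma trial_risk_move s : valid s ->
  let h a := trial_risk s (arena_move s a).1 in
  h Xpos + h Xneg + h Ypos + h Yneg <= 4 * trial_risk s (posx s).
Proof.
move=> _ /=; rewrite /trial_risk; case: ifPn => [le_g|]; last by lra.
have -> : (base s < posx s) by move: le_g; rewrite /gate; lia.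
rewrite /= -!mulrDl mulrA -mulrDr; apply: ler_wpM2r; first by rewrite invr_ge0 ler0n.
by rewrite !(intrD, rmorphN) /=; set u := _ ^+ _; lra.
Qed.

Lemma trial_ratio_ge0 k : 0 <= trial_ratio k.
Proof. by rewrite divr_ge0 ?ler0n. Qed.

Lemma trial_risk_ge0 s (x : int) : x <= goal s -> 0 <= trial_risk s x.
Proof.
move=> xg; rewrite /trial_risk; case: ifP => _; last by rewrite exprn_ge0 ?trial_ratio_ge0.
by rewrite !mulr_ge0 ?exprn_ge0 ?trial_ratio_ge0 ?invr_ge0 ?ler0n ?ler0z //; lia.
Qed.

Lemma future_risk_ge0 k : 0 <= future_risk k.
Proof. by rewrite divr_ge0 ?ler0n ?exprn_ge0. Qed.

Lemma return_risk_ge0 s (x y : int) : valid s -> x <= goal s ->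
  0 <= return_risk (stage s) (x - base s) y.
Proof.
move=> [_ _ _ vt] xg; rewrite /return_risk; apply: divr_ge0; last by rewrite ler0n.
have [x0|x0] := ltP (x - base s) 0.
  have : (x - base s)%:~R < 0 :> R by rewrite ltrz0.
  by have : 0 <= (10 * stage s + 13)%:R :> R := ler0n _ _; lra.
apply: green_ge0; first by rewrite ler0z.
have xe : x - base s <= (1 + trials (stage s) * corridor (stage s).+1)%:Z.
  have : ((trial s).+1 * corridor (stage s).+1 <= trials (stage s) * corridor (stage s).+1)%N.
    by rewrite leq_mul2r vt orbT.
  by move: xg; rewrite /goal /gate mulSn !PoszD; lia.
have [n ne] : exists n : nat, x - base s = n%:Z by exists `|x - base s|%N; lia.
move: xe; rewrite ne => xe.
rewrite /box; have -> : n%:Z%:~R = n%:R :> R by [].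
rewrite -!natrX -natrD natr1 ler_nat.
have {}xe : (n <= 2 * 2 ^ (5 * stage s + 4))%N.
  have e : (trials (stage s) * corridor (stage s).+1 = 2 ^ (5 * stage s + 4))%N.
    rewrite /trials /corridor -(@expnM 2 2) -!expnD; congr (2 ^ _)%N; lia.
  have : (0 < 2 ^ (5 * stage s + 4))%N by rewrite expn_gt0.
  by move: xe; rewrite e; lia.
have -> : (2 ^ (10 * stage s + 12) = 16 * (2 ^ (5 * stage s + 4)) ^ 2)%N.
  by rewrite -expnM -(@expnD 2 4); congr (2 ^ _)%N; lia.
have : (0 < 2 ^ (5 * stage s + 4))%N by rewrite expn_gt0.
by move: xe; set z := (2 ^ (_ + 4))%N => *; nia.
Qed.

Lemma one_plus_le_exp (z : R) n : 0 <= z -> 1 + n%:R * z <= (1 + z) ^+ n.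
Proof.
move=> z0; elim: n => [|n IH]; first by rewrite mul0r addr0 expr0.
rewrite exprS -natr1; have : 0 <= n%:R :> R := ler0n _ n.
by nra.
Qed.

(** Bernoulli's inequality gives [(1 + 1/C)^(2^k C) >= 1 + 2^k] for [C = corridor k.+1]. *)
Lemma trial_ratio_exp_le k : trial_ratio k ^+ trials k <= 2^-1 ^+ k.
Proof.
have c0 : 0 < (corridor k.+1)%:R :> R by rewrite ltr0n corridor_gt0.
have p0 : 0 < 2 ^+ k :> R by rewrite exprn_gt0.
have e : trial_ratio k = (1 + (corridor k.+1)%:R^-1)^-1.
  rewrite /trial_ratio -natr1; move: c0; set c := (_%:R) => c0.
  by field; rewrite !lt0r_neq0 //; lra.
have q0 : 0 < 1 + (corridor k.+1)%:R^-1 :> R by rewrite addr_gt0 ?invr_gt0.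
rewrite e !exprVn lef_pV2 ?posrE ?exprn_gt0 //.
apply: le_trans (one_plus_le_exp _ _); last by rewrite invr_ge0 ltW.
by rewrite /trials natrM natrX mulfK ?lt0r_neq0 //; lra.
Qed.

Lemma risk_start k b r : risk (Some (start k b r)) <= future_risk k.
Proof.
rewrite /risk /= !subrr /return_risk /= green_origin.
have -> : trial_risk (start k b r) b = trial_ratio k ^+ trials k.
  by rewrite /trial_risk ifN ?subn0 // /gate /=; lia.
have := trial_ratio_exp_le k; rewrite exprVn /future_risk exprS.
have p0 : 0 < 2 ^+ k :> R by rewrite exprn_gt0.
have : (10 * k + 13)%:R / (corridor k).+1%:R <= 13 / 2 ^+ k :> R.
  rewrite ler_pdivrMr ?ltr0n // mulrAC ler_pdivlMr // -natrX -!natrM ler_nat.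
  have : (k < 2 ^ k)%N by rewrite ltn_expl.
  rewrite /corridor (_ : 4 ^ k = 2 ^ k * 2 ^ k)%N; last by rewrite -expnMn.
  by set z := (2 ^ k)%N; nia.
rewrite invfM; set u := (2 ^+ k)^-1; set v := _ / _; set w := _ ^+ _.
lra.
Qed.

(** The right side moves the walk but keeps the bookkeeping of [s]. Each update made by [advance]
    (failure, new stage, new trial, arrival at the gate) can only lower this value. *)
Lemma risk_advance s a : valid s ->
  risk (advance s a) <=
  return_risk (stage s) ((arena_move s a).1 - base s) ((arena_move s a).2 - row s)
  + trial_risk s (arena_move s a).1 + future_risk (stage s).+1.
Proof.
move=> vs; have [vl vr vc vt] := vs.
have mx := arena_move_x s a; rewrite /advance; set p := arena_move s a in mx *.
have pg : p.1 <= goal s by lia.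
have fr := future_risk_ge0 (stage s).+1.
have tr := trial_risk_ge0 pg.
have cg := corridor_gt0 (stage s).+1.
case: ifPn => c1.
  have : 1 <= return_risk (stage s) (p.1 - base s) (p.2 - row s).
    rewrite /return_risk ifT; last by lia.
    rewrite ler_pdivlMr ?ltr0n // mul1r.
    have -> : p.1 - base s = - (corridor (stage s)).+1%:Z by lia.
    by rewrite rmorphN /= opprK lerDr ler0n.
  by rewrite /=; lra.
have rr := return_risk_ge0 (p.2 - row s) vs pg.
case: ifPn => c2; first by have := risk_start (stage s).+1 (goal s) (trow s); lra.
have c0 : 0 < (corridor (stage s).+1).+1%:R :> R by rewrite ltr0n.
case: ifPn => [/andP[c3 c4]|c3].
  have e : trial_risk s p.1 = trial_ratio (stage s) ^+ (trials (stage s) - (trial s).+1).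
    rewrite /trial_risk c3; have -> : goal s - p.1 = (corridor (stage s).+1).+1%:Z.
      by move: c3 c4; rewrite /goal; lia.
    by rewrite -[_%:~R]/(_%:R) mulfK // lt0r_neq0.
  rewrite e; case: ifPn => c5 /=.
    rewrite [trial_risk _ _]/trial_risk /= ifN // /gate /= -ltNge.
    by move: c3 c4; rewrite /gate mulSn; lia.
  have -> : (trials (stage s) - (trial s).+1 = 0)%N by lia.
  by rewrite expr0; lra.
rewrite /= -!addrA lerD2l lerD2r.
rewrite /trial_risk {1}/gate {1}/gate /= -/(gate s) /goal {1}/gate /= -/(gate s).
have [c4|c4] := leP (gate s) p.1; have [c5|c5] := leP (gate s) (posx s) => //.
  2: by move: c3; rewrite c4 c5.
(* The walk has just arrived at the gate, where the linear factor is exactly one [trial_ratio]. *)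
have -> : gate s + (corridor (stage s).+1)%:Z - p.1 = (corridor (stage s).+1)%:Z by lia.
rewrite -[_%:~R]/(_%:R) -mulrA -/(trial_ratio (stage s)) -exprSr.
by have -> : ((trials (stage s) - (trial s).+1).+1 = trials (stage s) - trial s)%N by lia.
Qed.

Lemma risk_supermartingale s : valid s ->
  risk (advance s Xpos) + risk (advance s Xneg) + risk (advance s Ypos)
  + risk (advance s Yneg) <= 4 * risk (Some s).
Proof.
move=> vs.
have := risk_advance Xpos vs; have := risk_advance Xneg vs.
have := risk_advance Ypos vs; have := risk_advance Yneg vs.
have := return_risk_move vs; have := trial_risk_move vs.
rewrite [risk (Some s)]/risk /=; lra.
Qed.

Lemma risk_ge0 s : valid s -> 0 <= risk (Some s).
Proof.
move=> vs; have [_ vr _ _] := vs.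
by rewrite /= !addr_ge0 ?return_risk_ge0 ?trial_risk_ge0 ?future_risk_ge0 // ltW.
Qed.

End potential.
(** * Runs driven by the random word *)

Fixpoint run (S : Type) (f : S -> letter -> option S) (s : S)
    (w : nat -> letter) (n : nat) : option S :=
  if n is m.+1 then obind (f^~ (w m)) (run f s w m) else Some s.

Lemma eq_run (S : Type) (f : S -> letter -> option S) s w w' n :
  (forall i, (i < n)%N -> w i = w' i) -> run f s w n = run f s w' n.
Proof.
elim: n => //= n IH ww; rewrite ww // IH // => i ltin.
by apply: ww; exact: ltnW.
Qed.

Lemma run_NoneS (S : Type) (f : S -> letter -> option S) s w n m :
  (n <= m)%N -> run f s w n = None -> run f s w m = None.
Proof.
by elim: m => [|m IH]; rewrite leq_eqVlt => /predU1P[->//|//] /IH {}IH /IH /= ->.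
Qed.

Lemma negligible_small d (T : measurableType d) (R : realType)
    (P : probability T R) (N : set T) :
  (forall e : R, 0 < e -> exists2 A, measurable A & N `<=` A /\ (P A <= e%:E)%E) ->
  P.-negligible N.
Proof.
move=> small.
have /choice[A A_] : forall j : nat, exists A,
    [/\ measurable A, N `<=` A & (P A <= (j.+1%:R^-1)%:E)%E].
  move=> j; have [|A mA [NA PA]] := small j.+1%:R^-1; first by rewrite invr_gt0 ltr0n.
  by exists A.
exists (\bigcap_j A j); split.
- by apply: bigcapT_measurable => j; have [] := A_ j.
- apply/eqP; rewrite eq_le measure_ge0 andbT; apply/lee_addgt0Pr => e e0.
  rewrite add0e; pose j := Num.truncn e^-1.
  have [mA _ PA] := A_ j.
  apply: (@le_trans _ _ (P (A j))).
    apply: le_measure; rewrite ?inE //; last exact: bigcap_inf.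
    by apply: bigcapT_measurable => i; have [] := A_ i.
  apply: le_trans PA _; rewrite lee_fin invf_ple ?posrE ?ltr0n //.
  by apply: ltW; apply: truncnS_gt.
- by apply: sub_bigcap => j _; have [] := A_ j.
Qed.

Section words.
Context (R : realType) (d : measure_display) (T : measurableType d).
Context (P : probability T R) (W : nat -> {RV P >-> letter}).
Context (W_uniform : forall n, uniform_letter (W n)).
Context (W_indep : mutually_independent W).
Context (S : Type) (f : S -> letter -> option S) (s0 : S).

Definition word (omega : T) (n : nat) : letter := W n omega.

Definition cylinder (u : seq letter) : set T :=
  [set omega | forall i, (i < size u)%N -> word omega i = nth Xpos u i].

Lemma cylinderE u : cylinder u =
  \bigcap_(n in [set` seq_fset tt (iota 0 (size u))]) (W n @^-1` [set nth Xpos u n]).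
Proof.
have mem i : (i \in seq_fset tt (iota 0 (size u))) = (i < size u)%N.
  by rewrite seq_fsetE mem_iota.
apply/seteqP; split=> omega h i.
  by move=> iu; apply: h; rewrite -mem.
by rewrite -mem; exact: h.
Qed.

Lemma probability_cylinder u : P (cylinder u) = ((4^-1) ^+ size u)%:E.
Proof.
rewrite cylinderE W_indep //.
under eq_bigr => n _.
  rewrite (_ : P _ = (4^-1)%:E); last exact: (W_uniform n (nth Xpos u n)).
  over.
have prod_cst (r : seq nat) :
    (\prod_(i <- r) (4^-1)%:E = (4^-1 ^+ size r)%:E :> \bar R)%E.
  by elim: r => [|i r IH]; rewrite ?big_nil // big_cons IH /= exprS EFinM.
rewrite prod_cst; congr (_ ^+ _)%:E.
by apply: etrans (size_seq_fset _ _) _; rewrite undup_id ?iota_uniq // size_iota.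
Qed.

(** All sets [B] are treated at once, so that the induction may pull [B] back along the last
    letter. *)
Lemma measurable_run n (B : set (option S)) :
  measurable [set omega | B (run f s0 (word omega) n)].
Proof.
elim: n B => [|n IH] B /=.
  by case: (pselect (B (Some s0))) => [/[dup] b /propT ->|/[dup] b /propF ->];
    [exact: measurableT | exact: measurable0].
rewrite (_ : [set _ | _] = \bigcup_(a in [set: letter])
   ((W n @^-1` [set a]) `&` [set omega | B (obind (f^~ a) (run f s0 (word omega) n))])).
  apply: fin_bigcup_measurable => [|a _]; first exact: finite_finset.
  apply: measurableI; first exact: measurable_funPTI.
  exact: (IH [set o | B (obind (f^~ a) o)]).
apply/seteqP; split=> [omega /= b | omega [a _ [/= <-]] //].
by exists (word omega n).
Qed.

Lemma measurable_cylinder u : measurable (cylinder u).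
Proof.
rewrite cylinderE; apply: bigcap_measurableType => i _.
exact: measurable_funPTI.
Qed.

Context (V : option S -> R) (inv : S -> Prop).
Context (inv_step : forall s a s', inv s -> f s a = Some s' -> inv s').
Context (V_ge0 : forall s, inv s -> 0 <= V (Some s)) (V_None : V None = 1).
Context (V_step : forall s, inv s ->
  V (f s Xpos) + V (f s Xneg) + V (f s Ypos) + V (f s Yneg) <= 4 * V (Some s)).
Context (inv0 : inv s0).

Let stop n := [set omega | run f s0 (word omega) n = None].

Let measurable_stop n : measurable (stop n).
Proof. exact: (measurable_run n [set o | o = None]). Qed.

Let inv_run w n s : run f s0 w n = Some s -> inv s.
Proof.
elim: n s => [|n IH] s /=; first by move=> [<-].
by case: (run f s0 w n) IH => //= s1 /(_ _ erefl) /inv_step h; apply: h.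
Qed.

(** Optional stopping by hand: given that the word begins with [u], the run stops within [n] more
    letters with probability at most the value of [V] reached after [u]. The induction splits the
    cylinder by its next letter and applies [V_step]. *)
Let cylinder_stop n u :
  (P (cylinder u `&` stop (n + size u)) <=
   (4^-1 ^+ size u * V (run f s0 (nth Xpos u) (size u)))%:E)%E.
Proof.
have c0 k : 0 <= (4^-1 : R) ^+ k by rewrite exprn_ge0 // invr_ge0.
elim: n u => [|n IH] u.
  rewrite add0n; case E : (run f s0 (nth Xpos u) (size u)) => [s|].
    rewrite (_ : _ `&` _ = set0) ?measure0 ?lee_fin.
      by rewrite mulr_ge0 ?V_ge0 //; apply: inv_run E.
    apply/seteqP; split=> // omega [/= cu]; rewrite /stop /=.
    by rewrite (@eq_run _ _ _ _ (nth Xpos u)) ?E.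
  rewrite V_None mulr1 -probability_cylinder.
  apply: le_measure; rewrite ?inE; last exact: subIsetl.
    by apply: measurableI => //; exact: measurable_cylinder.
  exact: measurable_cylinder.
pose C a := cylinder (rcons u a) `&` stop (n + size (rcons u a)).
have mC a : measurable (C a) by apply: measurableI => //; exact: measurable_cylinder.
have PC a : (P (C a) <= (4^-1 ^+ (size u).+1 *
    V (obind (f^~ a) (run f s0 (nth Xpos u) (size u))))%:E)%E.
  apply: le_trans (IH _) _; rewrite size_rcons lee_fin ler_wpM2l //=.
  rewrite nth_rcons ltnn eqxx (@eq_run _ _ _ _ (nth Xpos u)) // => i iu.
  by rewrite nth_rcons iu.
have sub : cylinder u `&` stop (n.+1 + size u)
    `<=` C Xpos `|` C Xneg `|` C Ypos `|` C Yneg.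
  move=> omega [cu st].
  have : C (word omega (size u)) omega.
    split; last by rewrite size_rcons addnS.
    move=> i; rewrite size_rcons ltnS leq_eqVlt nth_rcons => /predU1P[->|iu].
      by rewrite ltnn eqxx.
    by rewrite iu; exact: cu.
  by case: (word omega (size u)) => ?; [left; left; left|left; left; right|left; right|right].
apply: (@le_trans _ _ (P (C Xpos `|` C Xneg `|` C Ypos `|` C Yneg))).
  apply: le_measure; rewrite ?inE //.
    by apply: measurableI => //; exact: measurable_cylinder.
  by do 3! [apply: measurableU => //].
apply: (@le_trans _ _ (P (C Xpos) + P (C Xneg) + P (C Ypos) + P (C Yneg))%E).
  do 3! [apply: le_trans; first (apply: measureU2 => //; by do 2! [try apply: measurableU => //])
    ; apply: leeD => //].
apply: le_trans; first by do 3! [apply: leeD; last exact: PC]; exact: PC.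
rewrite -!EFinD lee_fin -!mulrDr exprSr -mulrA ler_wpM2l //.
case E : (run f s0 (nth Xpos u) (size u)) => [s|] /=.
  by have := V_step (inv_run E); lra.
by rewrite V_None; lra.
Qed.

(** Take the empty prefix in [cylinder_stop] and let [n] grow; a stopped run stays stopped, so the
    events increase. *)
Lemma probability_stop :
  (P [set omega | exists n, run f s0 (word omega) n = None] <= (V (Some s0))%:E)%E.
Proof.
rewrite (_ : [set _ | _] = \bigcup_n stop n); last first.
  by apply/seteqP; split=> omega [n] => [|_] h; exists n.
have mU : measurable (\bigcup_n stop n) by apply: bigcupT_measurable.
have mono : {homo stop : n m / (n <= m)%N >-> (n <= m)%O}.
  by move=> n m nm; apply/subsetPset => omega; apply: run_NoneS.
have cv := nondecreasing_cvg_mu (mu := P) measurable_stop mU mono.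
rewrite -(cvg_lim _ cv) //; apply: lime_le; first by apply/cvg_ex; eexists; exact: cv.
apply: nearW => n /=.
have := cylinder_stop n [::]; rewrite /= addn0 expr0 mul1r.
by rewrite (_ : cylinder [::] = setT) ?setTI //; apply/seteqP; split.
Qed.

Lemma measurable_exists_stop :
  measurable [set omega | exists n, run f s0 (word omega) n = None].
Proof.
rewrite (_ : [set _ | _] = \bigcup_n stop n); first exact: bigcupT_measurable.
by apply/seteqP; split=> omega [n] => [|_] h; exists n.
Qed.

End words.
(** * Long runs of eastward steps *)

Definition has_streaks (w : nat -> letter) : Prop :=
  forall L, exists n, forall i, (i < L)%N -> w (n + i)%N = Xpos.

(* The first component is the length of the current run of [Xpos], frozen once
   it is [L]; the second is the number of letters left before giving up. *)
Definition streak_step (L : nat) (s : nat * nat) (a : letter) : option (nat * nat) :=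
  if s.1 == L then Some s
  else if s.2 is j.+1 then Some (if a == Xpos then s.1.+1 else 0, j) else None.

Lemma streak_run L N w n c j : run (streak_step L) (0, N)%N w n = Some (c, j) ->
  (c != L -> j + n = N)%N /\
  exists2 m, (c != L -> m + c = n)%N & forall i, (i < c)%N -> w (m + i)%N = Xpos.
Proof.
elim: n c j => [|n IH] c j /=.
  by case=> <- <-; rewrite addn0; split=> //; exists 0%N.
case: (run _ _ _ n) IH => [[c1 j1]|] //= /(_ _ _ erefl) [jn [m mc hm]].
rewrite /streak_step /=; have [cL [<- <-]|cL] := eqVneq c1 L.
  by rewrite cL eqxx; split=> //; exists m => // i; rewrite -cL; exact: hm.
case: j1 jn => // j1 jn [<- <-]; split; first by move: (jn cL); lia.
case: (w n =P Xpos) => wn; last by exists n.+1; rewrite ?addn0.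
exists m => [_|i]; first by rewrite addnS mc.
by rewrite ltnS leq_eqVlt => /predU1P[->|/hm //]; rewrite mc.
Qed.

Section streaks.
Context (R : realType) (d : measure_display) (T : measurableType d).
Context (P : probability T R) (W : nat -> {RV P >-> letter}).
Context (W_uniform : forall n, uniform_letter (W n)).
Context (W_indep : mutually_independent W).

(* [(4^(L+1) - 4^(c+1)) / 3] is the expected number of letters needed to extend
   a run of length [c] to one of length [L]. *)
Let delay (L N : nat) (o : option (nat * nat)) : R :=
  if o is Some (c, j) then
    if c == L then 0
    else (4 ^+ L.+1 - 4 ^+ c.+1 + 3 * (N%:R - j%:R)) / (3 * N%:R)
  else 1.

Let delay_ge0 L N c j : (c <= L)%N -> (j <= N)%N -> 0 <= delay L N (Some (c, j)).
Proof.
move=> cL jN; rewrite /delay; case: ifP => // _.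
rewrite divr_ge0 ?mulr_ge0 ?ler0n // addr_ge0 ?mulr_ge0 ?subr_ge0 ?ler_nat //.
by rewrite -!natrX ler_nat leq_pexp2l.
Qed.

Lemma ae_has_streaks : {ae P, forall omega, has_streaks (word W omega)}.
Proof.
apply: ae_foralln => L; apply: negligible_small => e e0.
(* Makes the initial value of [delay], at most [4 ^ L.+1 / (3 * N)], smaller than [e]. *)
pose N := (Num.truncn (4 ^+ L.+1 / e)).+1.
exists [set omega | exists n, run (streak_step L) (0, N)%N (word W omega) n = None].
  exact: measurable_exists_stop.
split=> [omega /= nostreak|].
  (* A run alive after [N + 1] letters must be frozen, since the clock allows only [N]. *)
  exists N.+1; case E : run => [[c j]|] //.
  have [jn [m _ hm]] := streak_run E.
  have [cL|/jn] := eqVneq c L; last by lia.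
  by case: nostreak; exists m; rewrite -cL.
have N0 : 0 < N%:R :> R by rewrite ltr0n.
pose inv (s : nat * nat) := (s.1 <= L)%N /\ (s.2 <= N)%N.
apply: le_trans (@probability_stop _ _ _ P W W_uniform W_indep _ _ (0, N)%N
  (delay L N) inv _ _ _ _ _) _ => //.
- move=> [c j] a [c' j'] [/= cL jN]; rewrite /streak_step /=.
  case: eqVneq => [_ [<- <-] //|ncL]; case: j jN => // j jN [<- <-].
  by split=> /=; [case: ifP => _; lia | lia].
- by move=> [c j] [cL jN]; exact: delay_ge0.
- move=> [c j] [/= cL jN]; rewrite /streak_step /=.
  case: eqVneq => [->|ncL]; first by rewrite /delay eqxx; lra.
  have {ncL}cL : (c < L)%N by rewrite ltn_neqAle ncL.
  have pos z : 0 <= z -> 0 <= z / (3 * N%:R) :> R.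
    by move=> z0; rewrite divr_ge0 // mulr_ge0 ?ler0n.
  case: j jN => [|j] jN.
    rewrite /delay; have h : 4 ^+ c.+1 <= 4 ^+ L.+1 :> R.
      by rewrite -!natrX ler_nat leq_pexp2l // ltnS ltnW.
    (* With no letter left, the clock term alone is the value 1 given to failure. *)
    suff : 1 <= (4 ^+ L.+1 - 4 ^+ c.+1 + 3 * (N%:R - 0%:R)) / (3 * N%:R) :> R by lra.
    by rewrite ler_pdivlMr ?mulr_gt0 //; lra.
  rewrite {2 3 4}/delay.
  have -> : (0%N == L) = false by lia.
  have h : delay L N (Some (c.+1, j)) <=
     (4 ^+ L.+1 - 4 ^+ c.+2 + 3 * (N%:R - j%:R)) / (3 * N%:R).
    rewrite /delay; case: eqVneq => // ->; apply: pos.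
    by rewrite subrr add0r mulr_ge0 // subr_ge0 ler_nat ltnW.
  move: h; set u := delay _ _ _; rewrite -[j.+1%:R]natr1 expr1 [4 ^+ c.+2]exprS.
  set p := 4 ^+ c.+1; set q := 4 ^+ L.+1 => h.
  by set i := (3 * N%:R)^-1 in h *; lra.
rewrite lee_fin /delay; case: ifP => _; first exact: ltW.
rewrite subrr mulr0 addr0 ler_pdivrMr ?mulr_gt0 // expr1.
have : 4 ^+ L.+1 / e < N%:R by apply: truncnS_gt.
by rewrite ltr_pdivrMr //; nra.
Qed.
End streaks.

(** * The maze *)

Lemma advanceP s a s' : valid s -> advance s a = Some s' ->
  let p := arena_move s a in
  (s' = start (stage s).+1 (goal s) (trow s) /\ p.1 = goal s) \/
  [/\ stage s' = stage s, base s' = base s & row s' = row s] /\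
  [/\ posx s' = p.1, posy s' = p.2 & p.1 < goal s] /\
  ([/\ trial s' = trial s, gate s <= posx s -> gate s <= p.1 /\ trow s' = trow s
     & posx s < gate s -> trow s' = p.2] \/
   [/\ trial s' = (trial s).+1, gate s <= posx s & p.1 < gate s]).
Proof.
move=> [_ pg _ _] /=; rewrite /advance.
have := arena_move_x s a; case: (arena_move s a) => x y /= mx.
case: ifP => // _; case: ifPn => [gx [<-]|gx].
  by left; split=> //; lia.
case: ifPn => [/andP[c1 c2]|].
  by case: ifP => // _ [<-]; right; split=> //=; split; [split=> //; lia | right].
move=> c [<-]; right; split=> //=; split; first by split=> //; lia.
by left; split=> // h; [move: c; rewrite h /= -leNgt | rewrite leNgt h].
Qed.

Section maze.
Context (b e r : nat -> int) (c : nat -> nat).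
Context (c_gt0 : forall j, (0 < c j)%N) (b_lt_e : forall j, b j < e j).
Context (bS : forall j, b j.+1 = e j + (c j.+1)%:Z).

Let left j := b j - (c j)%:Z.

(* Arena [j] occupies the columns from [b j] to [e j - 1]; the corridor leading
   to it has row [r j] and the [c j] columns to the left of [b j]. *)
Definition in_arena (x : int) : Prop := exists j, b j <= x < e j.

(** This concerns the edge from column [x] to [x + 1]. The extra [- 1] provides the edge from the
    last column of the preceding arena into the corridor; for [j = 0] it is a dead end. *)
Definition east_open (x y : int) : Prop :=
  (in_arena x /\ in_arena (x + 1)) \/
  exists j, b j - (c j)%:Z - 1 <= x < b j /\ y = r j.

Definition maze_edge (u v : site) : Prop :=
  (u.1 = v.1 /\ (v.2 = u.2 + 1 \/ u.2 = v.2 + 1) /\ in_arena u.1) \/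
  (u.2 = v.2 /\ ((v.1 = u.1 + 1 /\ east_open u.1 u.2) \/
                 (u.1 = v.1 + 1 /\ east_open v.1 v.2))).

Lemma maze_edge_sym : symmetric (fun u v => `[< maze_edge u v >]).
Proof.
move=> u v; apply/asbool_equiv_eq; rewrite /maze_edge.
by split=> -[[-> [[]]]|[-> []]]; tauto.
Qed.

Lemma maze_edge_lattice : subrel (fun u v => `[< maze_edge u v >]) lattice_adj.
Proof.
move=> [u1 u2] [v1 v2] /asboolP; rewrite /maze_edge /lattice_adj /=.
by move=> [[-> [[]-> _]]|[-> [[-> _]|[-> _]]]]; apply/eqP; ring.
Qed.

Definition maze : spanning_subgraph :=
  SpanningSubgraph maze_edge_sym maze_edge_lattice.

Lemma maze_left_le i j : (i < j)%N -> e i <= left j.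
Proof.
elim: j => // j IH; rewrite ltnS leq_eqVlt => /predU1P[->|/IH]; rewrite /left bS; first by lia.
by have := b_lt_e j; lia.
Qed.

Lemma not_in_arena j x : left j <= x < b j -> ~ in_arena x.
Proof.
move=> /andP[lx xb] [i /andP[bx xe]].
have [ij|ji|ij] := ltngtP i j; last by move: bx; rewrite ij; lia.
  by have := maze_left_le ij; lia.
by have := maze_left_le ji; have := b_lt_e j; rewrite /left; lia.
Qed.

Lemma east_open_corridor j x : left j - 1 <= x < b j -> east_open x (r j).
Proof. by right; exists j. Qed.

Lemma east_open_arena j x y : b j <= x -> x + 1 < e j -> east_open x y.
Proof. by move=> bx xe; left; split; exists j; lia. Qed.

Lemma not_east_open j y : y != r j -> ~ east_open (b j - 1) y.
Proof.
move=> yr [[/(@not_in_arena j) + _]|[i [/andP[ix xi] yi]]].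
  by apply; have := c_gt0 j; rewrite /left; lia.
have [ij|ji|ij] := ltngtP i j; last by move: yr; rewrite yi ij eqxx.
  by have := maze_left_le ij; have := b_lt_e i; have := c_gt0 j; rewrite /left; lia.
by have := maze_left_le ji; have := b_lt_e j; rewrite /left; lia.
Qed.

Definition maze_move (v : site) (a : letter) : site :=
  if maze v (v + step a) then v + step a else v.

Lemma maze_move_E x y : east_open x y -> maze_move (x, y) Xpos = (x + 1, y).
Proof.
move=> h; rewrite /maze_move ifT; first by congr (_, _); rewrite addr0.
by apply/asboolP; right; split=> /=; [rewrite addr0 | left].
Qed.

Lemma maze_move_W x y : east_open (x - 1) y -> maze_move (x, y) Xneg = (x - 1, y).
Proof.
move=> h; rewrite /maze_move ifT; first by congr (_, _); rewrite addr0.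
apply/asboolP; right; split=> /=; first by rewrite addr0.
by right; split; [lia | rewrite /= addr0].
Qed.

Lemma maze_move_W_closed x y : ~ east_open (x - 1) y -> maze_move (x, y) Xneg = (x, y).
Proof.
move=> h; rewrite /maze_move ifN //; apply/asboolP => -[[/= ] | [_ /= [[]|[_]]]].
- by lia.
- by lia.
- by rewrite addr0.
Qed.

Lemma maze_move_NS x y a : in_arena x -> (step a).1 = 0 ->
  maze_move (x, y) a = (x, y + (step a).2).
Proof.
move=> h a0; rewrite /maze_move ifT; first by rewrite [step a]surjective_pairing a0 /=; congr (_, _); rewrite addr0.
apply/asboolP; left; rewrite /= a0 addr0; split=> //; split=> //.
by case: a a0 => //= _; [left|right]; lia.
Qed.

Lemma maze_move_NS_closed x y a : ~ in_arena x -> (step a).1 = 0 ->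
  maze_move (x, y) a = (x, y).
Proof.
move=> h a0; rewrite /maze_move ifN //; apply/asboolP => -[[_ [_ /= //]]|[_ /=]].
by rewrite a0; lia.
Qed.

End maze.
(** * The walk in the maze follows the process *)

Section trajectory.
Context (w : nat -> letter) (w_streaks : has_streaks w) (k0 : nat).
Context (s : nat -> state) (s0 : s 0 = start k0 0 0).
Context (sS : forall n, advance (s n) (w n) = Some (s n.+1)).

Let s_valid n : valid (s n).
Proof.
by elim: n => [|n IH]; [rewrite s0; exact: valid_start | exact: valid_advance IH (sS n)].
Qed.

(** A stage that never ended would meet an eastward streak longer than its total width. *)
Lemma stage_not_constant n : exists m, (n <= m)%N /\ stage (s m) != stage (s n).
Proof.
apply: contrapT => const.
have {const}st m : (n <= m)%N -> stage (s m) = stage (s n).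
  by move=> nm; apply: contrapT => /eqP h; apply: const; exists m.
have same m : (n <= m)%N -> base (s m.+1) = base (s m) /\ posx (s m.+1) = (arena_move (s m) (w m)).1.
  move=> nm; have [[e _]|[[_ -> _] [[-> _ _] _]]//] := advanceP (s_valid m) (sS m).
  by have := st m.+1 (leqW nm); rewrite e /= (st m nm); lia.
have bs m : (n <= m)%N -> base (s m) = base (s n).
  elim: m => [|m IH]; first by rewrite leqn0 => /eqP ->.
  by rewrite leq_eqVlt => /predU1P[->//|nm]; rewrite (same m nm).1 IH.
pose k := stage (s n).
pose L := (corridor k + 2 + trials k * corridor k.+1)%N.
(* The additional [n] letters ensure that the last [L] of the streak are read after time [n]. *)
have [m hm] := w_streaks (n + L).
have run_east i : (i <= L)%N -> posx (s (m + n + i)) = posx (s (m + n)) + i%:Z.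
  elim: i => [|i IH] iL; first by rewrite addn0 addr0.
  rewrite addnS (same _ _).2; last by lia.
  rewrite -addnA hm ?addnA; last by lia.
  by rewrite /= IH; lia.
have := run_east L (leqnn _).
have nm : (n <= m + n)%N by lia.
have nmL : (n <= m + n + L)%N by lia.
have [vl _ _ _] := s_valid (m + n); have [_ vr _ vt] := s_valid (m + n + L).
move: vl vr vt; rewrite /goal /gate !st // !bs // -/k => vl vr vt.
have : ((trial (s (m + n + L))).+1 * corridor k.+1 <= trials k * corridor k.+1)%N.
  by rewrite leq_mul2r vt orbT.
by rewrite mulSn; move: vl vr; rewrite /L !PoszD; lia.
Qed.

Lemma stage_end n : exists m, [/\ (n <= m)%N,
  forall i, (n <= i <= m)%N ->
    [/\ stage (s i) = stage (s n), base (s i) = base (s n) & row (s i) = row (s n)],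
  s m.+1 = start (stage (s n)).+1 (goal (s m)) (trow (s m)) &
  (arena_move (s m) (w m)).1 = goal (s m)].
Proof.
have ex : exists m, (n <= m)%N && (stage (s m) != stage (s n)).
  by have [m [nm h]] := stage_not_constant n; exists m; rewrite nm.
have [[|m] /andP[nm st] min] := ex_minnP ex.
  by move: nm st; rewrite leqn0 => /eqP ->; rewrite eqxx.
have {}nm : (n <= m)%N.
  by move: nm; rewrite leq_eqVlt => /predU1P[e|//]; move: st; rewrite e eqxx.
have {}min i : (n <= i <= m)%N -> stage (s i) = stage (s n).
  move=> /andP[ni im]; apply/eqP; apply: contraT => h.
  by have := min i; rewrite ni h => /(_ isT); lia.
have same i : (n <= i < m)%N -> base (s i.+1) = base (s i) /\ row (s i.+1) = row (s i).
  move=> im; have [[e _]|[[_ -> ->] _]//] := advanceP (s_valid i) (sS i).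
  have := min i.+1; rewrite e /= min; last by lia.
  by move=> h; have := h ltac:(lia); lia.
exists m; split=> //.
- elim=> [|i IH] ni; first by have -> : n = 0%N by lia.
  have [e|ne] := eqVneq n i.+1; first by rewrite e.
  have [h1 h2] := same i ltac:(lia); have [_ h3 h4] := IH ltac:(lia).
  by rewrite h1 h2 h3 h4 min.
- have [[e _]|[[e _ _] _]] := advanceP (s_valid m) (sS m); first by rewrite e min // leqnn nm.
  by move: st; rewrite e min ?leqnn ?nm // eqxx.
- have [[_ e]//|[[e _ _] _]] := advanceP (s_valid m) (sS m).
  by move: st; rewrite e min ?leqnn ?nm // eqxx.
Qed.

Let last_time := projT1 (choice stage_end).
Let last_timeP n := projT2 (choice stage_end) n.

Fixpoint entry (j : nat) : nat := if j is i.+1 then (last_time (entry i)).+1 else 0.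

Let b j := base (s (entry j)).
(** The arena ends at the gate of its successful trial, which is known only when the stage is
    over. *)
Let e j := gate (s (last_time (entry j))).
Let r j := row (s (entry j)).
Let c j := corridor (k0 + j).

Lemma entry_start j : s (entry j) = start (k0 + j) (b j) (r j).
Proof.
rewrite /b /r; case: j => [|j]; first by rewrite /= s0 addn0.
rewrite /=; have [_ _ -> _] := last_timeP (entry j) => /=; congr start.
elim: j => [|j IH]; first by rewrite /= s0 addn1.
by rewrite /=; have [_ _ -> _] := last_timeP (entry j); rewrite /= IH !addnS.
Qed.

Let stage_entry j : stage (s (entry j)) = (k0 + j)%N.
Proof. by rewrite entry_start. Qed.

Let c_gt0 j : (0 < c j)%N. Proof. exact: corridor_gt0. Qed.

Let stage_dataE j n : (entry j <= n <= last_time (entry j))%N ->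
  [/\ stage (s n) = (k0 + j)%N, base (s n) = b j & row (s n) = r j].
Proof.
by have [_ h _ _] := last_timeP (entry j); move=> /h; rewrite stage_entry.
Qed.

Let entry_le_last j : (entry j <= last_time (entry j))%N.
Proof. by have [] := last_timeP (entry j). Qed.

Let b_lt_e j : b j < e j.
Proof.
have [_ h _] := @stage_dataE j (last_time (entry j)) ltac:(by rewrite entry_le_last leqnn).
by rewrite /e /gate h; lia.
Qed.

Let goalE j : goal (s (last_time (entry j))) = e j + (c j.+1)%:Z.
Proof.
have [h _ _] := @stage_dataE j (last_time (entry j)) ltac:(by rewrite entry_le_last leqnn).
by rewrite /goal /e /c h addnS.
Qed.

Let entryS j : s (entry j.+1) = start (k0 + j).+1 (e j + (c j.+1)%:Z) (trow (s (last_time (entry j)))).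
Proof. by rewrite /=; have [_ _ -> _] := last_timeP (entry j); rewrite goalE stage_entry. Qed.

Let bS j : b j.+1 = e j + (c j.+1)%:Z. Proof. by rewrite /b entryS. Qed.

Let rS j : r j.+1 = trow (s (last_time (entry j))). Proof. by rewrite /r entryS. Qed.

Let step_in_stage j n : (entry j <= n < last_time (entry j))%N ->
  [/\ posx (s n.+1) = (arena_move (s n) (w n)).1,
      posy (s n.+1) = (arena_move (s n) (w n)).2,
      (arena_move (s n) (w n)).1 < goal (s n) &
  ([/\ trial (s n.+1) = trial (s n), gate (s n) <= posx (s n) -> gate (s n) <= posx (s n.+1) /\ trow (s n.+1) = trow (s n)
     & posx (s n) < gate (s n) -> trow (s n.+1) = posy (s n.+1)] \/
   [/\ trial (s n.+1) = (trial (s n)).+1, gate (s n) <= posx (s n) & posx (s n.+1) < gate (s n)])].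
Proof.
move=> hn; have [[h _]|[_ [[-> -> ?] ?]]//] := advanceP (s_valid n) (sS n).
have [h1 _ _] := @stage_dataE j n ltac:(lia).
have [h2 _ _] := @stage_dataE j n.+1 ltac:(lia).
by move: h2; rewrite h /= h1; lia.
Qed.

Let trial_mono j n m : (entry j <= n <= m)%N -> (m <= last_time (entry j))%N ->
  (trial (s n) <= trial (s m))%N.
Proof.
move=> /andP[jn]; elim: m => [|m IH]; first by rewrite leqn0 => /eqP ->.
rewrite leq_eqVlt => /predU1P[->//|nm] ml.
have := IH nm (ltnW ml); have [_ _ _] := @step_in_stage j m ltac:(lia).
by case=> [] [-> _ _]; lia.
Qed.

Let gate_in_stage j n : (entry j <= n <= last_time (entry j))%N ->
  gate (s n) = b j + 1 + (trial (s n) * c j.+1)%:Z /\ goal (s n) = gate (s n) + (c j.+1)%:Z.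
Proof.
move=> /stage_dataE[h1 h2 _]; rewrite /goal; have -> : corridor (stage (s n)).+1 = c j.+1.
  by rewrite h1 /c addnS.
by split=> //; rewrite /gate h2 h1 /c addnS.
Qed.

(* Trials before the successful one never get past its starting column. *)
Let trial_final j n : (entry j <= n <= last_time (entry j))%N -> 
  (trial (s n) < trial (s (last_time (entry j))))%N -> goal (s n) <= e j.
Proof.
move=> hn lt; have [g1 g2] := gate_in_stage hn.
have [g3 _] := @gate_in_stage j (last_time (entry j)) ltac:(by rewrite entry_le_last leqnn).
have : ((trial (s n)).+1 * c j.+1 <= trial (s (last_time (entry j))) * c j.+1)%N.
  by rewrite leq_mul2r lt orbT.
by rewrite mulSn /e g3 g2 g1; lia.
Qed.

(** Earlier trials stay west of their goal, hence west of [e j] by [trial_final]. *)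
Let trial_of_crossing j n : (entry j <= n <= last_time (entry j))%N -> e j <= posx (s n) ->
  trial (s n) = trial (s (last_time (entry j))) /\ gate (s n) = e j.
Proof.
move=> hn ex; have [_ vr _ _] := s_valid n.
have te : trial (s n) = trial (s (last_time (entry j))).
  have := @trial_mono j n (last_time (entry j)) hn (leqnn _).
  by rewrite leq_eqVlt => /predU1P[//|/(trial_final hn)]; lia.
split=> //; have [-> _] := gate_in_stage hn.
have [g3 _] := @gate_in_stage j (last_time (entry j)) ltac:(by rewrite entry_le_last leqnn).
by rewrite /e g3 te.
Qed.

(** Stepping back would raise the trial number above its final value. *)
Let crossing_persists j n : (entry j <= n < last_time (entry j))%N -> e j <= posx (s n) ->
  e j <= posx (s n.+1) /\ trow (s n.+1) = trow (s n).
Proof.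
move=> hn ex; have [te ge] := @trial_of_crossing j n ltac:(lia) ex.
have [_ _ _ []] := step_in_stage hn; rewrite ge; first by move=> [_ /(_ ex)].
move=> [t1 _ _]; have := @trial_mono j n.+1 (last_time (entry j)) ltac:(lia) (leqnn _).
by rewrite t1 te ltnn.
Qed.

(** Induction on the time left in the stage: [trow] stays frozen until the end, where [rS]
    identifies it. *)
Let crossing_row j n : (entry j <= n <= last_time (entry j))%N -> e j <= posx (s n) ->
  trow (s n) = r j.+1.
Proof.
rewrite rS; move: {2}(_ - n)%N (erefl (last_time (entry j) - n)%N) => k.
elim: k n => [|k IH] n kn hn ex; first by congr (trow (s _)); lia.
have [ex' <-] := @crossing_persists j n ltac:(lia) ex.
by apply: IH => //; lia.
Qed.

(* Beyond column [e j] the successful trial is under way, and the walk is in the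
   corridor instead of the position recorded in [s n]. *)
Let position j n : site := (posx (s n), if e j <= posx (s n) then r j.+1 else posy (s n)).

Let H := maze b e r c.

Let move_before_crossing j n : (entry j <= n < last_time (entry j))%N -> posx (s n) < e j ->
  maze_move b e r c (posx (s n), posy (s n)) (w n) = position j n.+1.
Proof.
move=> hn xe; have [ts bs rs] := @stage_dataE j n ltac:(lia).
have [px py pg tr] := step_in_stage hn.
have [vl _ vc _] := s_valid n; rewrite bs ts -/(c j) rs in vl vc.
have cj := c_gt0 j.
rewrite /position px py; move: px py pg tr; case: (w n) => /=.
- move=> px py pg tr; have [xe'|xe'] := leP (e j) (posx (s n) + 1).
    have ex : e j <= posx (s n.+1) by rewrite px.
    have ry := crossing_row (_ : (entry j <= n.+1 <= last_time (entry j))%N) ex.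
    have {}ry : trow (s n.+1) = r j.+1 by apply: ry; lia.
    (* Entering column [e j] starts the successful trial, so [trow] has just been set to the current
       row. *)
    have yr : posy (s n) = r j.+1.
      have [g1 g2] := @trial_of_crossing j n.+1 ltac:(lia) ex.
      case: tr => [[t1 _ t3]|[t1 t2 t3]].
        rewrite -py -t3 //; have [gs _] := @gate_in_stage j n ltac:(lia).
        by have [gs1 _] := @gate_in_stage j n.+1 ltac:(lia); rewrite gs -t1 -gs1 g2.
      have [gs gl] := @gate_in_stage j n ltac:(lia).
      by have := @trial_final j n ltac:(lia) ltac:(lia); lia.
    rewrite yr; apply: maze_move_E; apply: east_open_corridor.
    by rewrite bS; have := c_gt0 j.+1; lia.
  apply: maze_move_E; have [bx|xb] := leP (b j) (posx (s n)).
    exact: east_open_arena bx xe'.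
  by rewrite vc //; apply: east_open_corridor; lia.
- rewrite bs rs => px py pg tr; case: ifPn px py pg tr => /= [bx|/norP[bx yr]] px py pg tr.
    rewrite ifN; last by rewrite -ltNge; lia.
    have [{}bx|xb] := ltP (b j) (posx (s n)).
      by apply: maze_move_W; apply: (@east_open_arena _ _ _ _ j); lia.
    have -> : posy (s n) = r j by apply/eqP; move: bx; rewrite ltNge xb.
    by apply: maze_move_W; apply: east_open_corridor; lia.
  rewrite ifN; last by rewrite -ltNge.
  apply: maze_move_W_closed.
  have -> : posx (s n) = b j.
    by apply/eqP; move: yr; apply: contraNT => ne; rewrite vc //; lia.
  exact: (not_east_open c_gt0 b_lt_e bS yr).
- move=> px py pg tr; rewrite ifN -?ltNge // bs; case: ifPn => bx.
    by rewrite maze_move_NS //; exists j; lia.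
  by rewrite maze_move_NS_closed //; apply: (not_in_arena b_lt_e bS (j := j)); lia.
- move=> px py pg tr; rewrite ifN -?ltNge // bs; case: ifPn => bx.
    by rewrite maze_move_NS //; exists j; lia.
  by rewrite maze_move_NS_closed //; apply: (not_in_arena b_lt_e bS (j := j)); lia.
Qed.

(** The course of a trial depends on horizontal letters only, so the corridor, which refuses
    vertical ones, carries the walk through the same columns. *)
Let move_after_crossing j n : (entry j <= n <= last_time (entry j))%N -> e j <= posx (s n) ->
  maze_move b e r c (posx (s n), r j.+1) (w n) = ((arena_move (s n) (w n)).1, r j.+1).
Proof.
move=> hn ex; have [ts bs rs] := @stage_dataE j n ltac:(lia).
have [_ gs] := @trial_of_crossing j n ltac:(lia) ex.
have [_ vr _ _] := s_valid n; have [_ gl] := @gate_in_stage j n ltac:(lia).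
rewrite gl gs in vr; have bx : b j < posx (s n) by have := b_lt_e j; lia.
have cj := c_gt0 j.+1.
have closed : ~ in_arena b e (posx (s n)).
  by apply: (not_in_arena b_lt_e bS (j := j.+1)); rewrite bS; lia.
case: (w n) => /=; rewrite ?bs ?bx /=.
- by apply: maze_move_E; apply: east_open_corridor; rewrite bS; lia.
- by apply: maze_move_W; apply: east_open_corridor; rewrite bS; lia.
- exact: maze_move_NS_closed.
- exact: maze_move_NS_closed.
Qed.

Let move_in_stage j n : (entry j <= n < last_time (entry j))%N ->
  maze_move b e r c (position j n) (w n) = position j n.+1.
Proof.
move=> hn; rewrite {1}/position; case: ifPn => ex; last first.
  by apply: move_before_crossing => //; rewrite ltNge.
rewrite move_after_crossing //; last by lia.
have [-> _ _ _] := step_in_stage hn; rewrite /position.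
have [ex' _] := crossing_persists hn ex.
by have [<- _ _ _] := step_in_stage hn; rewrite ex'.
Qed.

Let move_last j : maze_move b e r c (position j (last_time (entry j))) (w (last_time (entry j)))
  = (b j.+1, r j.+1).
Proof.
have [_ _ _ g] := last_timeP (entry j).
have hn : (entry j <= last_time (entry j) <= last_time (entry j))%N by rewrite entry_le_last leqnn.
have cj := c_gt0 j.+1.
have ex : e j <= posx (s (last_time (entry j))).
  by have := arena_move_x (s (last_time (entry j))) (w (last_time (entry j))); rewrite g goalE; lia.
by rewrite /position ex move_after_crossing // g goalE bS.
Qed.

Let walk := induced_walk w H.

Let walkS n : walk n.+1 = maze_move b e r c (walk n) (w n).
Proof. by []. Qed.

Let walk_in_stage j : walk (entry j) = (b j, r j) ->
  forall n, (entry j <= n <= last_time (entry j))%N -> walk n = position j n.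
Proof.
move=> wj; elim=> [|n IH] hn.
  have e0 : entry j = 0%N by lia.
  rewrite -e0 wj /position entry_start /=.
  by have := b_lt_e j; case: leP => //; lia.
have [en|en] := eqVneq (entry j) n.+1.
  rewrite -en wj /position entry_start /=.
  by have := b_lt_e j; case: leP => //; lia.
by rewrite walkS IH ?move_in_stage //; lia.
Qed.

Lemma walk_entry j : walk (entry j) = (b j, r j).
Proof.
elim: j => [|j IH]; first by rewrite /b /r /= s0.
by rewrite /= walkS (walk_in_stage IH) ?move_last ?entry_le_last ?leqnn.
Qed.

(** * Transience and unvisited sites *)

Let maze_left j := b j - (c j)%:Z.

(** During stage [j] this is [valid_left]; afterwards the stronger bound for [j.+1] applies, with
    less time elapsed since the entry. *)
Lemma walk_right_of j n : (entry j <= n)%N -> maze_left j <= (walk n).1.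
Proof.
move: {2}(n - entry j)%N (leqnn (n - entry j)) => k.
elim: k j => [|k IH] j kn jn; have [nl|ln] := leqP n (last_time (entry j)).
- rewrite (walk_in_stage (walk_entry j)) ?jn //=.
  have [vl _ _ _] := s_valid n; have [h1 h2 h3] := @stage_dataE j n ltac:(lia).
  by move: vl; rewrite h1 h2.
- by have := entry_le_last j; lia.
- rewrite (walk_in_stage (walk_entry j)) ?jn //=.
  have [vl _ _ _] := s_valid n; have [h1 h2 h3] := @stage_dataE j n ltac:(lia).
  by move: vl; rewrite h1 h2.
have := IH j.+1; rewrite /= => /(_ _ ln) h.
apply: le_trans (h _); last by have := entry_le_last j; lia.
by rewrite /maze_left bS; have := b_lt_e j; have := c_gt0 j; lia.
Qed.

Lemma maze_left_ge j : j%:Z <= maze_left j + (c 0)%:Z.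
Proof.
elim: j => [|j IH]; first by rewrite /maze_left /b s0 /=; lia.
by move: IH; rewrite /maze_left bS; have := b_lt_e j; have := c_gt0 j; lia.
Qed.

Lemma walk_visits_finite v : finite_set [set n | walk n = v].
Proof.
(* For this [j], [maze_left_ge] puts [maze_left j] east of [v]. *)
pose j := (`|v.1| + c 0).+1; apply: (@sub_finite_set _ _ `I_(entry j)); last exact: finite_II.
move=> n /= nv; rewrite ltnNge; apply/negP => jn; move: (@walk_right_of j n jn).
by have := maze_left_ge j; rewrite nv /j; lia.
Qed.

Lemma maze_reachable_column0 (y : nat) : reachable H (0, y%:Z).
Proof.
elim: y => [|y [p [pH pl]]]; first by exists [::].
exists (rcons p (0, y.+1%:Z)); split; last by rewrite last_rcons.
rewrite rcons_path pH pl /=; apply/asboolP; left; split=> //=; split; first by left; lia.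
by exists 0%N; have := b_lt_e 0; rewrite {1 2}/b /= s0 /=; lia.
Qed.

(** Column 0 is out of reach from time [entry 1] on, and before that the height is below [entry 1],
    so every site of the column from that height upwards is missed. *)
Lemma walk_unvisited_infinite :
  infinite_set [set v : site | reachable H v /\ forall n, walk n <> v].
Proof.
have bound n : `|(walk n).2| <= n%:Z.
  elim: n => [|n IH] //; rewrite walkS /maze_move; case: ifP => _ /=; last by lia.
  by case: (w n) => /=; lia.
pose f (i : nat) : site := (0, (entry 1 + i)%:Z).
have f_inj : injective f by move=> i i' []; lia.
move=> /(finite_preimage (f := f)) fin; apply: infinite_nat.
rewrite (_ : setT = f @^-1` [set v : site | reachable H v /\ forall n, walk n <> v]).
  by apply: fin => i i' _ _ /f_inj.
apply/seteqP; split=> // i _; split; first exact: maze_reachable_column0.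
move=> n wn; have [n1|n1] := leqP (entry 1) n.
  have b0 : b 0 = 0 by rewrite /b s0.
  have := @walk_right_of 1 n n1; rewrite wn /maze_left bS.
  by have := b_lt_e 0; rewrite b0 [(f i).1]/=; lia.
by have := bound n; rewrite wn -[(f i).2]/((entry 1 + i)%:Z); lia.
Qed.

End trajectory.

(** * Almost sure existence of the maze *)

Lemma maze_exists (w : nat -> letter) (k : nat) :
  has_streaks w -> (forall n, run advance (start k 0 0) w n <> None) ->
  exists H : spanning_subgraph,
    let walk := induced_walk w H in
    (forall v : site, reachable H v -> finite_set [set n | walk n = v]) /\
    infinite_set [set v : site | reachable H v /\ forall n, walk n <> v].
Proof.
(* The default is never taken, as [alive] excludes [None]. *)
move=> ws alive; pose s n := odflt (start k 0 0) (run advance (start k 0 0) w n).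
have sE n : run advance (start k 0 0) w n = Some (s n).
  by rewrite /s; case: run (alive n).
have sS n : advance (s n) (w n) = Some (s n.+1).
  by have := sE n.+1; rewrite /= sE.
have s0 : s 0 = start k 0 0 by [].
eexists; split=> [v _|]; first exact: (walk_visits_finite ws s0 sS).
exact: (@walk_unvisited_infinite w ws k s s0 sS).
Qed.

Theorem theorem1p1 (R : realType) (d : measure_display)
    (T : measurableType d) (P : probability T R)
    (W : nat -> {RV P >-> letter})
    (W_uniform : forall n, uniform_letter (W n))
    (W_indep : mutually_independent W) :
  {ae P, forall omega : T, exists H : spanning_subgraph,
    let walk := induced_walk (fun n => W n omega) H in
    (forall v : site, reachable H v -> finite_set [set n | walk n = v]) /\
    infinite_set [set v : site | reachable H v /\ forall n, walk n <> v]}.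
Proof.
suff alive : {ae P, forall omega, exists k, forall n,
    run advance (start k 0 0) (word W omega) n <> None}.
  apply: filterS2 (ae_has_streaks W_uniform W_indep) alive => omega ws [k hk].
  exact: maze_exists ws hk.
apply: negligible_small => eps eps0.
(* If all starts fail then so does the start at this [k], with probability at most [28 / 2 ^ k];
   moreover [28 / eps < k + 1 <= 2 ^ k]. *)
pose k := Num.truncn (28 / eps).
exists [set omega | exists n, run advance (start k 0 0) (word W omega) n = None].
  exact: measurable_exists_stop.
split=> [omega /= dead|].
  by apply: contrapT => noex; apply: dead; exists k => n hn; apply: noex; exists n.
apply: le_trans (probability_stop W_uniform W_indep (V := @risk R)
  valid_advance (@risk_ge0 R) _ (@risk_supermartingale R) (valid_start k 0 0)) _ => //.
rewrite lee_fin; apply: le_trans (risk_start R k 0 0) _.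
rewrite /future_risk ler_pdivrMr ?exprn_gt0 //.
have h1 : 28 / eps < k.+1%:R by apply: truncnS_gt.
have h2 : k.+1%:R <= 2 ^+ k :> R by rewrite -natrX ler_nat ltn_expl.
by move: h1; rewrite ltr_pdivrMr //; nra.
Qed.
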